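(* Let $p$ be an odd prime and let $f(x)\in\mathbb{F}_p[x]$. Suppose there are an integer $n$ with $2<n<\frac p2$ and elements $b_0,b_1,b_{2n-1},b_{2n}\in\mathbb{F}_p$ such that $$f(x)^2=b_0+b_1x+b_{2n-1}x^{2n-1}+b_{2n}x^{2n}.$$ Then $f$ is a monomial.
   Context: $\mathbb{F}_p$ is the field with $p$ elements. A monomial means a polynomial of the form $cx^m$ with $c\in\mathbb{F}_p$ and $m\ge 0$ an integer (constants, including $0$, count as monomials). *)

(* Defs.v *)
From mathcomp Require Import all_boot all_order all_algebra.

Set Implicit Arguments.
Unset Strict Implicit.
Unset Printing Implicit Defensive.

Import GRing.Theory.
Local Open Scope ring_scope.

(* The coefficient may be 0, so constants, including the zero polynomial,
   are monomials. *)
Definition is_monomial (R : nzRingType) (f : {poly R}) : Prop :=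
  exists (c : R) (m : nat), f = c *: 'X^m.

(* Main.v *)
Require Import Defs.
From mathcomp Require Import all_boot all_order all_algebra.
From mathcomp Require Import zify ring.

Set Implicit Arguments.
Unset Strict Implicit.
Unset Printing Implicit Defensive.

Import GRing.Theory.
Local Open Scope ring_scope.

(** The polynomial [g = f ^+ 2] satisfies [2 g f' = g' f].  If [b0 != 0], then,
    since [g = b0 + b1 X] up to order [2n - 2], this gives the recurrence
    [2 b0 (k + 1) f_(k + 1) = b1 (1 - 2k) f_k] for [k < 2n - 2] (that of the
    binomial series of the square root of [b0 + b1 X]).  If [b1 != 0], it
    propagates [f_(n + 1) = 0] downwards to [f_0 = 0], a contradiction; if
    [b1 = 0], it makes [f] constant.  If [b0 = 0], the even coefficients of [g]
    below [2n] all vanish, so [f] has no term of degree less than [n], while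
    [deg f <= n]. *)

Lemma drop_polyK (R : nzSemiRingType) (f : {poly R}) (m : nat) :
  (forall i, (i < m)%N -> f`_i = 0) -> f = drop_poly m f * 'X^m.
Proof.
move=> f_lt; rewrite -[LHS](poly_take_drop m f).
rewrite [take_poly m f](_ : _ = 0) ?add0r //.
by apply/polyP=> i; rewrite coef_take_poly coef0; case: ifP => // /f_lt.
Qed.

Lemma coef_sqr_double (R : comNzRingType) (f : {poly R}) (m : nat) :
  (forall i, (i < m)%N -> f`_i = 0) -> (f ^+ 2)`_(2 * m) = f`_m ^+ 2.
Proof.
move=> /drop_polyK f_def; rewrite {1}f_def exprMn -exprM coefMXn mulnC ltnn subnn.
by rewrite expr2 coef0M coef_drop_poly.
Qed.

Lemma coef_sqr_lt_eq0 (F : fieldType) (f : {poly F}) (n : nat) :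
  (forall i, (i < n)%N -> (f ^+ 2)`_(2 * i) = 0) ->
  forall i, (i < n)%N -> f`_i = 0.
Proof.
move=> f2_0 i; elim/ltn_ind: i => i IHi lt_in.
have := f2_0 i lt_in; rewrite coef_sqr_double => [/eqP|j lt_ji].
  by rewrite expf_eq0 => /eqP.
by apply: IHi => //; apply: ltn_trans lt_in.
Qed.

Lemma leq_size_sqr (F : fieldType) (f : {poly F}) (n : nat) :
  (size (f ^+ 2) <= (2 * n).+1)%N -> (size f <= n.+1)%N.
Proof.
have [-> _|f_neq0] := eqVneq f 0; first by rewrite size_poly0.
have := size_exp f 2.
have : (0 < size f)%N by rewrite size_poly_gt0.
have : (0 < size (f ^+ 2))%N by rewrite size_poly_gt0 expf_neq0.
by move: (size f) (size (f ^+ 2)) => m m2; lia.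
Qed.

(** Compares coefficients of [X^k] in [2 a f' = b1 f] modulo [X^N], where [a = b0 + b1 X]. This
    congruence comes from multiplying [2 f f' = b1] by [f], so nothing has to be inverted. *)
Lemma coef_sqrt_affine_rec (R : comNzRingType) (f : {poly R}) (N : nat)
    (b0 b1 : R) :
  (forall i, (i < N.+1)%N -> (f ^+ 2)`_i = (b0%:P + b1 *: 'X)`_i) ->
  forall k, (k < N)%N ->
    b0 * f`_k.+1 *+ k.+1 *+ 2 = b1 * f`_k - b1 * f`_k *+ k *+ 2.
Proof.
move=> f2_coef k lt_kN; set a := b0%:P + b1 *: 'X in f2_coef.
have [h f2E] : exists h, f ^+ 2 = a + h * 'X^(N.+1).
  exists (drop_poly N.+1 (f ^+ 2 - a)); rewrite -drop_polyK ?subrKC // => i lt_iN.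
  by rewrite coefB f2_coef ?subrr.
(* Differentiation costs one order of precision: the error drops from [X^(N.+1)] to [X^N]. *)
have f2d : f * f^`() *+ 2 = b1%:P + (h^`() * 'X + h *+ N.+1) * 'X^N.
  have := congr1 (@deriv R) f2E.
  rewrite expr2 !(derivM, derivD, derivZ, derivC, derivX, derivXn) /= exprS.
  rewrite add0r alg_polyC => f2d; transitivity (f^`() * f + f * f^`()); first by ring.
  by rewrite f2d -mulr_natr -[_ *+ N.+1]mulr_natr; ring.
have ode : f^`() * a *+ 2
    = f * b1%:P + (f * (h^`() * 'X + h *+ N.+1) - f^`() * h * 'X *+ 2) * 'X^N.
  have -> : a = f ^+ 2 - h * 'X^(N.+1) by rewrite f2E addrK.
  have -> : f^`() * (f ^+ 2 - h * 'X^(N.+1)) *+ 2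
    = f * (f * f^`() *+ 2) - f^`() * h * 'X * 'X^N *+ 2 by rewrite ['X^_]exprS; ring.
  by rewrite f2d; ring.
have := congr1 (fun q : {poly R} => q`_k) ode.
rewrite coefMn coefD coefMXn lt_kN addr0 coefMC mulrDr coefD coefMC coef_deriv.
rewrite -scalerAr coefZ coefMX coef_deriv.
have -> : (if k == 0%N then 0 else f`_k.-1.+1 *+ k.-1.+1) = f`_k *+ k by case: (k).
by rewrite [X in X - _]mulrC => <-; ring.
Qed.

(** The condition on [k%:R] stands in for [2 * n < p]; the integers to be cancelled are [2 * i.+1]
    with [i < n] and the odd numbers below [2 * n]. *)
Lemma sqr_sparse_monomial (F : fieldType) (n : nat) (f : {poly F})
    (b0 b1 b2n1 b2n : F) :
  (forall k, (0 < k <= 2 * n)%N -> k%:R != 0 :> F) -> (2 < n)%N ->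
  f ^+ 2 = b0%:P + b1 *: 'X + b2n1 *: 'X^(2 * n - 1) + b2n *: 'X^(2 * n) ->
  is_monomial f.
Proof.
move=> natF_neq0 n_gt2 f2E.
have coef_f2 i : (f ^+ 2)`_i = b0 *+ (i == 0)%N + b1 *+ (i == 1)%N
    + b2n1 *+ (i == 2 * n - 1)%N + b2n *+ (i == 2 * n)%N.
  by rewrite f2E !coefD !coefZ coefC coefX !coefXn !mulr_natr; case: eqP.
have size_f : (size f <= n.+1)%N.
  apply/leq_size_sqr/leq_sizeP => i lt_ni; rewrite coef_f2.
  have [-> -> -> ->] : [/\ i == 0 = false, i == 1 = false,
    i == (2 * n - 1) = false & i == (2 * n) = false]%N by split; lia.
  by rewrite !addr0.
have f_gt i : (n < i)%N -> f`_i = 0 by move=> lt_ni; apply: (leq_sizeP _ _ size_f).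
have [b0_eq0|b0_neq0] := eqVneq b0 0.
  have f_lt : forall i, (i < n)%N -> f`_i = 0.
    apply: coef_sqr_lt_eq0 => i lt_in; rewrite coef_f2 b0_eq0 mul0rn.
    have [-> -> ->] : [/\ 2 * i == 1 = false, 2 * i == (2 * n - 1) = false
      & 2 * i == (2 * n) = false]%N by split; lia.
    by rewrite !addr0.
  exists f`_n, n; apply/polyP=> i; rewrite coefZ coefXn.
  by have [/f_lt->|/f_gt->|->] := ltngtP i n; rewrite ?mulr0 ?mulr1.
have f_rec k : (k < 2 * n - 2)%N ->
    b0 * f`_k.+1 *+ k.+1 *+ 2 = b1 * f`_k - b1 * f`_k *+ k *+ 2.
  apply: coef_sqrt_affine_rec => i lt_i; rewrite coef_f2 coefD coefC coefZ coefX.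
  have [-> ->] : [/\ i == (2 * n - 1) = false & i == (2 * n) = false]%N.
    by split; lia.
  by rewrite !addr0 mulr_natr; case: eqP.
have [b1_eq0|b1_neq0] := eqVneq b1 0.
  exists f`_0, 0%N; apply/polyP=> -[|i]; rewrite coefZ coefXn ?mulr1 // mulr0.
  have [/f_gt //|le_in] := ltnP n i.+1.
  have /f_rec/eqP : (i < 2 * n - 2)%N by lia.
  rewrite b1_eq0 !mul0r !mul0rn subr0 -mulrnA -mulr_natr !mulf_eq0.
  by rewrite (negPf b0_neq0) (negPf (natF_neq0 _ _)) ?orbF /=; [move/eqP | lia].
(* Downward induction from index [n.+1], written as upward induction on [k]. The recurrence is used
   up to index [n], and [n < 2 * n - 2] is exactly [2 < n]. *)
have f_desc k : (k <= n.+1)%N -> f`_(n.+1 - k) = 0.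
  elim: k => [_|k IHk lt_kn]; first by rewrite subn0 f_gt.
  have := IHk (ltnW lt_kn); rewrite -(subnSK lt_kn).
  set m := (n.+1 - k.+1)%N => fm1; have le_mn : (m <= n)%N by lia.
  have /f_rec/esym/eqP : (m < 2 * n - 2)%N by lia.
  rewrite fm1 mulr0 !mul0rn -mulrnA -[X in X - _]mulr1n.
  (* The factor [1 - 2m] is [1] for [m = 0]; for [m = j.+1] it is the opposite of the natural number
     [2j + 1], which is nonzero in [F]. *)
  case: (m) le_mn => [_|j le_jn].
    by rewrite mul0n mulr0n subr0 mulr1n mulf_eq0 (negPf b1_neq0) => /eqP.
  rewrite -opprB oppr_eq0 -mulrnBr; last by lia.
  rewrite -mulr_natr !mulf_eq0 (negPf b1_neq0) (negPf (natF_neq0 _ _)) ?orbF /=.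
    by move/eqP.
  by lia.
case/eqP: b0_neq0; transitivity (f ^+ 2)`_0.
  have [E1 E2] : [/\ 0 == 2 * n - 1 = false & 0 == 2 * n = false]%N by split; lia.
  by rewrite coef_f2 E1 E2 !addr0.
by rewrite expr2 coef0M -(subnn n.+1) f_desc ?mul0r.
Qed.

Theorem theorem1p1 (p : nat) (p_prime : prime p) (p_odd : odd p)
    (f : {poly 'F_p})
    (hf : exists (n : nat) (b0 b1 b2n1 b2n : 'F_p),
        [/\ (2 < n)%N, (2 * n < p)%N
          & f ^+ 2 = b0%:P + b1 *: 'X + b2n1 *: 'X^(2 * n - 1)
                     + b2n *: 'X^(2 * n)]) :
  is_monomial f.
Proof.
case: hf => n [b0 [b1 [b2n1 [b2n [n_gt2 lt_2n_p f2E]]]]].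
apply: sqr_sparse_monomial n_gt2 f2E => k /andP[k_gt0 le_k2n].
rewrite -(dvdn_pcharf (pchar_Fp p_prime)) gtnNdvd //.
exact: leq_ltn_trans lt_2n_p.
Qed.
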